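(* If $\hat\rho_1\in\mathcal A_1$ (i.e. $\rho_1$ is $G$-invariant), then $$\lim_{n\to\infty}\frac1n\log P_{\min}(\rho_0^{\otimes n}:\rho_1^{\otimes n})\le\liminf_{n\to\infty}\frac1n\log P_{\min}(\rho_{0,n}:\rho_{1,n})\le\limsup_{n\to\infty}\frac1n\log P_{\min}(\rho_{0,n}:\rho_{1,n})\le\frac12\lim_{n\to\infty}\frac1n\log P_{\min}(\rho_0^{\otimes n}:\rho_1^{\otimes n}).$$
   Context: Let $\mathcal H$ be a finite-dimensional complex Hilbert space, $G$ a compact group and $g\mapsto u_g$ a continuous unitary representation of $G$ on $\mathcal H$. For $n\in\mathbb N$ let $\mathcal A_n=\{A\in\mathcal B(\mathcal H^{\otimes n}):Au_g^{\otimes n}=u_g^{\otimes n}A\ \forall g\in G\}$ and $E_{\mathcal A_n}(X)=\int_G u_g^{\otimes n}Xu_g^{*\otimes n}\,dg$ (normalized Haar measure). Let $\rho_0,\rho_1$ be states on $\mathcal B(\mathcal H)$ with densities $\hat\rho_0,\hat\rho_1$, and $\hat\rho_{k,n}:=E_{\mathcal A_n}(\hat\rho_k^{\otimes n})$. Define $P_{\min}(\rho_{0,n}:\rho_{1,n}):=\min\{\operatorname{Tr}\hat\rho_0^{\otimes n}(I-T)+\operatorname{Tr}\hat\rho_1^{\otimes n}T:\ T\in\mathcal A_n,\ 0\le T\le I\}$ and $P_{\min}(\rho_0^{\otimes n}:\rho_1^{\otimes n}):=\min\{\operatorname{Tr}\hat\rho_0^{\otimes n}(I-T)+\operatorname{Tr}\hat\rho_1^{\otimes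 n}T:\ T\in\mathcal B(\mathcal H^{\otimes n}),\ 0\le T\le I\}$. The limit $\lim_n\frac1n\log P_{\min}(\rho_0^{\otimes n}:\rho_1^{\otimes n})$ exists (and equals $\min_{0\le s\le1}\log\operatorname{Tr}\hat\rho_0^s\hat\rho_1^{1-s}$, by the quantum Chernoff bound). *)

(* Defs.v *)
(* Complex numbers are R[i] (real_closed
   complex) over an abstract R : realType; n-fold tensor powers are
   ntensmx (A ^t n) from real_closed/mxtens. *)
From HB Require Import structures.
From mathcomp Require Import all_boot all_order all_algebra.
From mathcomp Require Import complex mxtens.
From mathcomp Require Import all_classical all_reals all_analysis.
Set Implicit Arguments. Unset Strict Implicit. Unset Printing Implicit Defensive.
Import Order.TTheory GRing.Theory Num.Theory.
Local Open Scope ring_scope.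
Local Open Scope classical_set_scope.

Section QDefs.
Variable R : realType.
Local Notation C := R[i].

Definition adjmx m n (A : 'M[C]_(m, n)) : 'M[C]_(n, m) := (map_mx Num.conj A)^T.

Definition psdmx n (A : 'M[C]_n) : Prop :=
  A = adjmx A /\ forall v : 'rV[C]_n, 0 <= (v *m A *m adjmx v) 0 0.

Definition density d (rho : 'M[C]_d) : Prop := psdmx rho /\ \tr rho = 1.

Definition compact_unitary_rep (G : topologicalType) (mul : G -> G -> G)
  (inv : G -> G) (e : G) d (u : G -> 'M[C]_d) : Prop :=
  ((forall x y z, mul x (mul y z) = mul (mul x y) z) /\
   (forall x, mul e x = x /\ mul x e = x) /\
   (forall x, mul (inv x) x = e /\ mul x (inv x) = e)) /\
  (continuous (fun p : G * G => mul p.1 p.2) /\ continuous inv) /\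
  (hausdorff_space G /\ compact [set: G]) /\
  ((forall x y, u (mul x y) = u x *m u y) /\ u e = 1%:M) /\
  (forall x, u x *m adjmx (u x) = 1%:M) /\
  (forall i j, continuous (fun x : G => (complex.Re (u x i j) : R^o)) /\
               continuous (fun x : G => (complex.Im (u x i j) : R^o))).

Definition in_An d (G : Type) (u : G -> 'M[C]_d) n (T : 'M[C]_(d ^ n)) : Prop :=
  forall g, T *m (u g ^t n) = (u g ^t n) *m T.

(* Tr rho0^{(x)n} (I - T) + Tr rho1^{(x)n} T  (a real number for 0<=T<=I) *)
Definition perr d n (r0 r1 : 'M[C]_d) (T : 'M[C]_(d ^ n)) : R :=
  complex.Re (\tr (r0 ^t n *m (1%:M - T)) + \tr (r1 ^t n *m T)).

Definition Pmin_full d (r0 r1 : 'M[C]_d) n : R :=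
  inf [set perr r0 r1 T | T in [set T : 'M[C]_(d ^ n) | psdmx T /\ psdmx (1%:M - T)]].

(* P_min(rho_{0,n} : rho_{1,n}) : minimum over tests 0 <= T <= I with T in A_n *)
Definition Pmin_inv d (G : Type) (u : G -> 'M[C]_d) (r0 r1 : 'M[C]_d) n : R :=
  inf [set perr r0 r1 T | T in
        [set T : 'M[C]_(d ^ n) | [/\ in_An u T, psdmx T & psdmx (1%:M - T)]]].

Definition elog (x : R) : \bar R := if 0 < x then (ln x)%:E else -oo%E.

Definition rate (P : nat -> R) (n : nat) : \bar R := (((n%:R)^-1)%:E * elog (P n))%E.

End QDefs.

(* Main.v *)
(* Haar averaging is replaced by linear algebra.  Let V be the span of the matrices
   u_g ^t n, let K_k be a basis of V orthonormal for the Hilbert-Schmidt product, and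
   put D = sum_k K_k K_k^*, which is central in V and has trace v = dim V.  Since the
   sum sum_k K_k T K_k^* does not depend on the orthonormal basis, the twirl
   E(T) = D^-1 sum_k K_k T K_k^* commutes with the representation and
   Tr rho E(T) = Tr rho T for every invariant rho; a Cauchy-Schwarz inequality gives
   T <= v E(T).  Given a test T, the invariant test
   T' = 1 - lam (E(T) + lam)^-1 satisfies T' <= E(T) / lam and
   1 - T' <= (1 - T) + v lam.  With lam of the order of the square root of the error
   of T, the error of T' is at most (v + 2) times that square root, and v is
   polynomial in n because u_g ^t n lies in a space spanned by symmetric tensors. *)
Require Import Defs.
From HB Require Import structures.
From mathcomp Require Import all_boot all_order all_algebra.
From mathcomp Require Import complex mxtens.
From mathcomp Require Import all_classical all_reals all_analysis.
From mathcomp Require Import ring lra zify.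
Set Implicit Arguments. Unset Strict Implicit. Unset Printing Implicit Defensive.
Import Order.TTheory GRing.Theory Num.Theory numFieldNormedType.Exports.
Local Open Scope ring_scope.

(** * Adjoints, the real Hilbert-Schmidt product and positive semidefinite matrices *)

Section PositiveMatrices.
Variable R : realType.
Local Notation C := R[i].

Lemma adjmxM m n p (A : 'M[C]_(m, n)) (B : 'M[C]_(n, p)) :
  adjmx (A *m B) = adjmx B *m adjmx A.
Proof. by rewrite /adjmx map_mxM trmx_mul. Qed.

Lemma adjmxK m n (A : 'M[C]_(m, n)) : adjmx (adjmx A) = A.
Proof. by apply/matrixP => i j; rewrite !mxE conjCK. Qed.

Lemma adjmxD m n (A B : 'M[C]_(m, n)) : adjmx (A + B) = adjmx A + adjmx B.
Proof. by apply/matrixP => i j; rewrite !mxE rmorphD. Qed.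

Lemma adjmxN m n (A : 'M[C]_(m, n)) : adjmx (- A) = - adjmx A.
Proof. by apply/matrixP => i j; rewrite !mxE rmorphN. Qed.

Lemma adjmxZ m n a (A : 'M[C]_(m, n)) : adjmx (a *: A) = Num.conj a *: adjmx A.
Proof. by apply/matrixP => i j; rewrite !mxE rmorphM. Qed.

Lemma adjmx_sum m n (I : finType) (F : I -> 'M[C]_(m, n)) :
  adjmx (\sum_i F i) = \sum_i adjmx (F i).
Proof.
apply/matrixP => i j; rewrite !mxE !summxE rmorph_sum.
by apply: eq_bigr => k _; rewrite !mxE.
Qed.

Lemma adjmx1 n : adjmx (1%:M : 'M[C]_n) = 1%:M.
Proof. by rewrite /adjmx map_mx1 trmx1. Qed.

Lemma tr_adjmx n (A : 'M[C]_n) : \tr (adjmx A) = Num.conj (\tr A).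
Proof. by rewrite /adjmx mxtrace_tr trace_map_mx. Qed.

Lemma Re_conj (z : C) : complex.Re (Num.conj z) = complex.Re z.
Proof. by case: z. Qed.

Lemma Re_ge0 (z : C) : 0 <= z -> 0 <= complex.Re z.
Proof. by case: z => a b; rewrite lecE /= => /andP[]. Qed.

Lemma Re_real_mul (a : R) (z : C) :
  complex.Re (a%:C%C * z) = a * complex.Re z.
Proof. by case: z => x y /=; rewrite mul0r subr0. Qed.

Lemma conj_ge0 (z : C) : Num.conj z = z -> 0 <= complex.Re z -> 0 <= z.
Proof.
case: z => a b /= [] /eqP; rewrite -subr_eq0 -opprD oppr_eq0 => /eqP h a0.
by rewrite lecE /= a0 andbT; apply/eqP; lra.
Qed.

Lemma Re_sum (I : finType) (F : I -> C) :
  complex.Re (\sum_i F i) = \sum_i complex.Re (F i).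
Proof. exact: (raddf_sum (@complex.Re R)). Qed.

Lemma mxtrace_sum n (I : finType) (F : I -> 'M[C]_n) :
  \tr (\sum_i F i) = \sum_i \tr (F i).
Proof. exact: (raddf_sum (@mxtrace C n)). Qed.

(** Taking the real part gives a real bilinear form, so that inequalities live in [R]; the
    rectangular shape covers row vectors and square matrices alike. *)
Definition hsip m n (A B : 'M[C]_(m, n)) : R := complex.Re (\tr (A *m adjmx B)).

Lemma hsipC m n (A B : 'M[C]_(m, n)) : hsip A B = hsip B A.
Proof. by rewrite /hsip -Re_conj -tr_adjmx adjmxM adjmxK. Qed.

Lemma hsipDl m n (A A' B : 'M[C]_(m, n)) : hsip (A + A') B = hsip A B + hsip A' B.
Proof. by rewrite /hsip mulmxDl mxtraceD raddfD. Qed.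

Lemma hsipNl m n (A B : 'M[C]_(m, n)) : hsip (- A) B = - hsip A B.
Proof. by rewrite /hsip mulNmx raddfN raddfN. Qed.

Lemma hsipZl m n (a : R) (A B : 'M[C]_(m, n)) :
  hsip (a%:C%C *: A) B = a * hsip A B.
Proof. by rewrite /hsip -scalemxAl mxtraceZ Re_real_mul. Qed.

Lemma hsipDr m n (A B B' : 'M[C]_(m, n)) : hsip A (B + B') = hsip A B + hsip A B'.
Proof. by rewrite hsipC hsipDl !(hsipC A). Qed.

Lemma hsipNr m n (A B : 'M[C]_(m, n)) : hsip A (- B) = - hsip A B.
Proof. by rewrite hsipC hsipNl (hsipC A). Qed.

Lemma hsipZr m n (a : R) (A B : 'M[C]_(m, n)) :
  hsip A (a%:C%C *: B) = a * hsip A B.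
Proof. by rewrite hsipC hsipZl (hsipC A). Qed.

Lemma hsip_adj m n (A : 'M[C]_n) (x y : 'M[C]_(m, n)) :
  hsip (x *m A) y = hsip x (y *m adjmx A).
Proof. by rewrite /hsip adjmxM adjmxK mulmxA. Qed.

Lemma hsip_ge0 m n (A : 'M[C]_(m, n)) : 0 <= hsip A A.
Proof.
rewrite /hsip /mxtrace Re_sum sumr_ge0 // => i _; rewrite mxE Re_sum sumr_ge0 // => j _.
by rewrite !mxE; apply: Re_ge0; exact: mul_conjC_ge0.
Qed.

Lemma hsip_eq0 m n (A : 'M[C]_(m, n)) : hsip A A = 0 -> A = 0.
Proof.
have h i j : 0 <= complex.Re (A i j * Num.conj (A i j)).
  by apply: Re_ge0; exact: mul_conjC_ge0.
have -> : hsip A A = \sum_i \sum_j complex.Re (A i j * Num.conj (A i j)).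
  rewrite /hsip /mxtrace Re_sum; apply: eq_bigr => i _; rewrite mxE Re_sum.
  by apply: eq_bigr => j _; rewrite !mxE.
move/psumr_eq0P => H; apply/matrixP => i j; rewrite mxE.
have /psumr_eq0P := H (fun i _ => sumr_ge0 _ (fun j _ => h i j)) i isT.
move=> /(_ (fun j _ => h i j) j isT); case: (A i j) => a b /= ab0.
have -> : a = 0 by nra.
by have -> : b = 0 by nra.
Qed.

Lemma mulmx_rV_trE n (A : 'M[C]_n) (x y : 'rV[C]_n) :
  (x *m A *m adjmx y) 0 0 = \tr (x *m A *m adjmx y).
Proof. by rewrite /mxtrace big_ord1. Qed.

(** For Hermitian [A] the value of the quadratic form is its own conjugate, so only its real part
    has to be tested. *)
Lemma psdmxP n (A : 'M[C]_n) :
  psdmx A <-> A = adjmx A /\ forall x : 'rV_n, 0 <= hsip (x *m A) x.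
Proof.
split=> -[Ah Ap]; split=> // x.
  by have := Ap x; rewrite mulmx_rV_trE => /Re_ge0.
rewrite mulmx_rV_trE; apply: conj_ge0; last exact: Ap.
by rewrite -tr_adjmx !adjmxM adjmxK -Ah mulmxA.
Qed.

Lemma psdmx_hsip_ge0 m n (A : 'M[C]_n) (x : 'M[C]_(m, n)) :
  psdmx A -> 0 <= hsip (x *m A) x.
Proof.
move=> /psdmxP[_ Ap]; rewrite /hsip /mxtrace Re_sum sumr_ge0 // => i _.
have := Ap (row i x); rewrite /hsip /mxtrace big_ord1 -row_mul !mxE.
rewrite !Re_sum; under eq_bigr do rewrite !mxE.
by under [X in _ -> 0 <= X]eq_bigr do rewrite !mxE.
Qed.

Lemma psdmx_gram m n (Y : 'M[C]_(m, n)) : psdmx (adjmx Y *m Y).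
Proof.
apply/psdmxP; split; first by rewrite adjmxM adjmxK.
by move=> x; have := hsip_ge0 (x *m adjmx Y); rewrite /hsip adjmxM adjmxK !mulmxA.
Qed.

Lemma psdmx0 n : psdmx (0 : 'M[C]_n).
Proof. by have := psdmx_gram (0 : 'M[C]_(n, n)); rewrite mulmx0. Qed.

Lemma psdmx1 n : psdmx (1%:M : 'M[C]_n).
Proof. by have := psdmx_gram (1%:M : 'M[C]_(n, n)); rewrite mulmx1 adjmx1. Qed.

(** By the spectral theorem [A] is diagonal in a unitary basis; [Y] is the diagonal of square roots
    of the eigenvalues times that unitary. *)
Lemma psdmx_factor n (A : 'M[C]_n) : psdmx A -> exists Y : 'M[C]_n, A = adjmx Y *m Y.
Proof.
move=> [Ah Ap].
have An : A \is normalmx.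
  apply/normalmxP; have -> : (A ^t Num.conj)%sesqui = A; last by [].
  by rewrite [RHS]Ah /adjmx map_trmx.
move: (orthomx_spectralP An); set P := spectralmx A; set s := spectral_diag A => AE.
have PU : P \is unitarymx := spectral_unitarymx A.
have adjP : adjmx P = invmx P by rewrite (invmx_unitary PU) /adjmx map_trmx.
have PV : P *m adjmx P = 1%:M by rewrite adjP mulmxV // unitarymx_unit.
(* Each eigenvalue is the value of the quadratic form at a row of the unitary [P]. *)
have s_ge0 i : 0 <= s 0 i.
  have -> : s 0 i = (P *m A *m adjmx P) i i.
    by rewrite AE -adjP !mulmxA PV mul1mx -mulmxA PV mulmx1 mxE eqxx mulr1n.
  have -> : (P *m A *m adjmx P) i i = (row i P *m A *m adjmx (row i P)) 0 0.
    by rewrite -row_mul !mxE; apply: eq_bigr => j _; rewrite !mxE.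
  exact: Ap.
pose r := \row_i sqrtC (s 0 i).
exists (diag_mx r *m P).
rewrite adjmxM AE -adjP mulmxA -(mulmxA (adjmx P)); congr (_ *m _ *m _).
have -> : adjmx (diag_mx r) = diag_mx (\row_i Num.conj (r 0 i)).
  by apply/matrixP => i j; rewrite !mxE rmorphMn eq_sym; case: eqVneq => [->|].
rewrite mulmx_diag.
congr diag_mx; apply/rowP => i; rewrite !mxE.
have r_ge0 : 0 <= sqrtC (s 0 i) by rewrite sqrtC_ge0.
by rewrite (CrealP (ger0_real r_ge0)) -expr2 sqrtCK.
Qed.

(** Factoring [A] as [adjmx Y *m Y] and cycling the trace leaves the form of [B] at the rows of
    [Y]. *)
Lemma psdmx_tr_ge0 n (A B : 'M[C]_n) :
  psdmx A -> psdmx B -> 0 <= complex.Re (\tr (A *m B)).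
Proof.
move=> /psdmx_factor[Y ->] Bp; rewrite -mulmxA mxtrace_mulC.
exact: psdmx_hsip_ge0.
Qed.

End PositiveMatrices.

(** * The test built from the resolvent of a positive matrix *)

Lemma resolvent_arith (R : realType) (k lam zz zw ww Tzz Tzw Tww Szz : R) :
  0 < k -> 0 < lam -> Tzz <= k * Szz -> zw = Szz + lam * zz -> 0 <= Tzz ->
  0 <= lam * (lam * zz - zw) + (lam * - zw - - ww) +
    (lam * - (lam * Tzz - Tzw) - (- (lam * Tzw) - - Tww)) ->
  0 <= Tzz - k * Tzw + (- (k * Tzw) - - (k * (k * Tww))) ->
  0 <= ww - Tww ->
  0 <= ww - Tww + k * lam * ww - (ww - (ww - lam * zw)).
Proof.
move=> k_gt0 lam_gt0 q3 q5 q6 q1 q2 q4.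
(* The weight [c = lam / k] on the positivity of [T] at [z - k w] cancels the cross term [Tzw]. The
   remaining [c * Tzz] is at most [lam * Szz], which [q5] absorbs into [lam * zw]; finally
   [Tww <= ww] is used with weight [k * lam]. *)
have [c c_ge0 lamE] : exists2 c, 0 <= c & lam = c * k.
  by exists (lam / k); [rewrite divr_ge0 // ltW | rewrite divfK // gt_eqF].
have q2' := mulr_ge0 c_ge0 q2; have q3' := ler_wpM2l c_ge0 q3.
have q4' := mulr_ge0 (mulr_ge0 (ltW k_gt0) (ltW lam_gt0)) q4.
have q6' := mulr_ge0 (mulr_ge0 (ltW lam_gt0) (ltW lam_gt0)) q6.
have q5' := congr1 ( *%R lam) q5.
rewrite lamE in q1 q4' q5' q6' *.
clear -q1 q2' q3' q4' q5' q6'; lra.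
Qed.

Section ResolventTest.
Variable R : realType.
Local Notation C := R[i].
Variables (n : nat) (S T : 'M[C]_n) (k lam : R).
Hypotheses (S_psd : psdmx S) (T_psd : psdmx T) (T_le1 : psdmx (1%:M - T)).
Hypotheses (k_gt0 : 0 < k) (lam_gt0 : 0 < lam).
Hypothesis T_leS : forall x : 'rV[C]_n, hsip (x *m T) x <= k * hsip (x *m S) x.

Let M : 'M[C]_n := S + lam%:C%C *: 1%:M.
Let Z := invmx M.
(** This equals [S] times the inverse of [S + lam]: a smooth substitute for the spectral projection
    of [S] onto values above [lam]. *)
Definition resolvent_test : 'M[C]_n :=
  1%:M - lam%:C%C *: invmx (S + lam%:C%C *: 1%:M).
Local Notation T' := resolvent_test.

Let conj_real (a : R) : Num.conj (a%:C%C : C) = a%:C%C.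
Proof. exact: conjc_real. Qed.

Let S_herm : adjmx S = S. Proof. by case: S_psd. Qed.

Let T_herm : adjmx T = T. Proof. by case: T_psd. Qed.

Let M_herm : adjmx M = M.
Proof. by rewrite /M adjmxD adjmxZ conj_real adjmx1 S_herm. Qed.

Let M_unit : M \in unitmx.
Proof.
rewrite -row_free_unit; apply: inj_row_free => x xM0.
have := congr1 (fun y => hsip y x) xM0.
rewrite mulmxDr -scalemxAr mulmx1 hsipDl hsipZl.
have -> : hsip 0 x = 0 by rewrite /hsip mul0mx mxtrace0.
have := psdmx_hsip_ge0 x S_psd; have := hsip_ge0 x => x0 Sx e.
by apply: hsip_eq0; apply/eqP; rewrite eq_le x0 andbT -(pmulr_rle0 _ lam_gt0); lra.
Qed.

Let Z_herm : adjmx Z = Z.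
Proof.
have h : adjmx Z *m M = 1%:M by rewrite -{1}M_herm -adjmxM mulmxV // adjmx1.
by rewrite -[RHS]mul1mx -h mulmxK.
Qed.

Let T'_herm : T' = adjmx T'.
Proof.
by rewrite /resolvent_test -/M -/Z adjmxD adjmxN adjmxZ conj_real adjmx1 Z_herm.
Qed.

(** Writing [w = z (S + lam)] with [z = w Z] removes the inverse: [w T'] becomes [z S] and
    [w (1 - T')] becomes [lam z], so the bounds on [T'] reduce to positivity statements at [z]. *)
Let wE (w : 'rV[C]_n) : w = w *m Z *m S + lam%:C%C *: (w *m Z).
Proof. by rewrite -{1}[w](mulmxKV M_unit) mulmxDr -scalemxAr mulmx1. Qed.

Let wT' (w : 'rV[C]_n) : w *m T' = w - lam%:C%C *: (w *m Z).
Proof. by rewrite mulmxBr mulmx1 -scalemxAr. Qed.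

Let symT (x y : 'rV[C]_n) : hsip (x *m T) y = hsip (y *m T) x.
Proof. by rewrite hsip_adj T_herm hsipC. Qed.

Lemma resolvent_test_psd : psdmx T'.
Proof.
apply/psdmxP; split=> // w; rewrite wT'.
move: (wE w); set z := w *m Z => wz.
have -> : w - lam%:C%C *: z = z *m S by rewrite {1}wz addrK.
rewrite wz hsipDr hsipZr addr_ge0 ?hsip_ge0 //.
by rewrite mulr_ge0 ?(ltW lam_gt0) ?psdmx_hsip_ge0.
Qed.

Lemma resolvent_test_compl_psd : psdmx (1%:M - T').
Proof.
apply/psdmxP; split=> [|w]; first by rewrite adjmxD adjmxN adjmx1 -T'_herm.
rewrite mulmxBr mulmx1 wT' subKr.
move: (wE w); set z := w *m Z => wz.
rewrite wz hsipZl hsipDr hsipZr mulr_ge0 ?(ltW lam_gt0) // addr_ge0 //.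
  by rewrite hsipC psdmx_hsip_ge0.
by rewrite mulr_ge0 ?(ltW lam_gt0) ?hsip_ge0.
Qed.

(** In terms of [z], the difference sends [w] to [lam^-1 z S S]; pairing with [w = z S + lam z]
    gives the form of [S] at [z S] plus [lam] times the square norm of [z S]. *)
Lemma resolvent_test_le : psdmx ((lam^-1)%:C%C *: S - T').
Proof.
apply/psdmxP; split=> [|w].
  by rewrite adjmxD adjmxN adjmxZ conj_real S_herm -T'_herm.
rewrite mulmxBr wT' -scalemxAr.
move: (wE w); set z := w *m Z => wz.
have -> : w - lam%:C%C *: z = z *m S by rewrite {1}wz addrK.
have -> : (lam^-1)%:C%C *: (w *m S) - z *m S = (lam^-1)%:C%C *: (z *m S *m S).
  rewrite {1}wz mulmxDl -scalemxAl scalerDr scalerA.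
  have -> : (lam^-1)%:C%C * lam%:C%C = 1 :> C.
    by rewrite -rmorphM /= mulVf ?gt_eqF.
  by rewrite scale1r addrK.
rewrite hsipZl mulr_ge0 ?invr_ge0 ?(ltW lam_gt0) //.
rewrite wz hsipDr hsipZr addr_ge0 //; first exact: psdmx_hsip_ge0.
by rewrite mulr_ge0 ?(ltW lam_gt0) // hsip_adj S_herm hsip_ge0.
Qed.

Lemma resolvent_test_compl_le :
  psdmx (1%:M - T + (k * lam)%:C%C *: 1%:M - (1%:M - T')).
Proof.
apply/psdmxP; move: T'_herm wT'; move: T' => X Xh wX; split=> [|w].
  by rewrite !(adjmxD, adjmxN, adjmxZ) conj_real adjmx1 -Xh T_herm.
rewrite !(mulmxDr, mulmxN) !mulmx1 -scalemxAr mulmx1 wX.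
move: (wE w); set z := w *m Z => wz.
(* With [w = z (S + lam)], positivity of [1 - T] at [lam z - w] and of [T] at
   [z - k w] bounds [2 lam <z, w>], where [lam <z, w>] is the value of [1 - T'] at [w]. *)
have q1 := psdmx_hsip_ge0 (lam%:C%C *: z - w) T_le1.
have q2 := psdmx_hsip_ge0 (z - k%:C%C *: w) T_psd.
have q3 := T_leS z.
have q4 := psdmx_hsip_ge0 w T_le1.
have q5 : hsip z w = hsip (z *m S) z + lam * hsip z z.
  by rewrite {1}wz hsipDr hsipZr hsipC.
have q6 := psdmx_hsip_ge0 z T_psd.
move: q1 q2 q4; rewrite !(mulmxDr, mulmxN, mulmxDl, mulNmx, mulmx1, =^~ scalemxAl).
rewrite !(hsipDl, hsipDr, hsipNl, hsipNr, hsipZl, hsipZr).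
rewrite (symT w z) (hsipC w z).
move: q3 q5 q6; set zz := hsip z z; set zw := hsip z w; set ww := hsip w w.
set Tzz := hsip (z *m T) z; set Tzw := hsip (z *m T) w; set Tww := hsip (w *m T) w.
set Szz := hsip (z *m S) z => q3 q5 q6 q1 q2 q4.
exact: (resolvent_arith k_gt0 lam_gt0 q3 q5 q6 q1 q2 q4).
Qed.

Lemma resolvent_test_comm (U : 'M[C]_n) : S *m U = U *m S -> T' *m U = U *m T'.
Proof.
move=> SU; have MU : M *m U = U *m M.
  by rewrite mulmxDl mulmxDr SU -scalemxAl -scalemxAr mul1mx mulmx1.
have ZU : Z *m U = U *m Z.
  by rewrite -{1}[U](mulmxK M_unit) -MU -!mulmxA mulKmx.
by rewrite mulmxBl mulmxBr mul1mx mulmx1 -scalemxAl -scalemxAr -/M -/Z ZU.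
Qed.

End ResolventTest.

(** * Averaging over a set of unitaries through an orthonormal basis of its span *)

Section Twirl.
Variable R : realType.
Local Notation C := R[i].
Variables (m : nat) (P : 'M[C]_m -> Prop).
Hypotheses (P1 : P 1%:M) (PM : forall U V, P U -> P V -> P (U *m V)).
Hypotheses (Padj : forall U, P U -> P (adjmx U)).
Hypothesis PU : forall U, P U -> U *m adjmx U = 1%:M.
Variables (v r : nat) (K : 'I_v -> 'M[C]_m) (X : 'I_r -> 'M[C]_m) (Y : 'M[C]_(v, r)).
Hypotheses (PX : forall j, P (X j)) (KE : forall k, K k = \sum_j Y k j *: X j).
Hypothesis K_ortho : forall k l, \tr (K k *m adjmx (K l)) = (k == l)%:R.

Definition in_span (A : 'M[C]_m) := A = \sum_k \tr (A *m adjmx (K k)) *: K k.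

Hypothesis P_span : forall U, P U -> in_span U.

(** Each [K k] is a combination of members [X j] of [P], so a property that is stable under linear
    combinations passes from [P] to the span. *)
Lemma in_span_ind (Q : 'M[C]_m -> Prop) :
  Q 0 -> (forall a A B, Q A -> Q B -> Q (a *: A + B)) ->
  (forall U, P U -> Q U) -> forall A, in_span A -> Q A.
Proof.
move=> Q0 QL QP.
have Qsum n (c : 'I_n -> C) F : (forall i, Q (F i)) -> Q (\sum_i c i *: F i).
  move=> QF; elim/big_rec: _ => // i x _ Qx; exact: QL.
have QK k : Q (K k) by rewrite KE; apply: Qsum => j; exact: QP.
by move=> A ->; exact: Qsum.
Qed.

Lemma in_span0 : in_span 0.
Proof. by rewrite /in_span big1 // => k _; rewrite mul0mx mxtrace0 scale0r. Qed.

Lemma in_spanL a A B : in_span A -> in_span B -> in_span (a *: A + B).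
Proof.
rewrite /in_span => hA hB; rewrite {1}hA {1}hB scaler_sumr -big_split /=.
apply: eq_bigr => k _.
by rewrite mulmxDl -scalemxAl mxtraceD mxtraceZ scalerDl scalerA.
Qed.

Lemma in_span_sum n (F : 'I_n -> 'M[C]_m) :
  (forall i, in_span (F i)) -> in_span (\sum_i F i).
Proof.
move=> QF; elim/big_rec: _ => [|i x _ Qx]; first exact: in_span0.
by rewrite -[F i]scale1r; exact: in_spanL.
Qed.

Lemma in_span_basis k : in_span (K k).
Proof.
rewrite /in_span (bigD1 k) //= K_ortho eqxx scale1r big1 ?addr0 // => l lk.
by rewrite K_ortho eq_sym (negPf lk) scale0r.
Qed.

Lemma in_spanM A B : in_span A -> in_span B -> in_span (A *m B).
Proof.
move=> hA hB; move: A hA; apply: in_span_ind => [|a A A' hA hA'|U PUU].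
- by rewrite mul0mx; exact: in_span0.
- by rewrite mulmxDl -scalemxAl; exact: in_spanL.
move: B hB; apply: in_span_ind => [|a A A' hA hA'|V PV].
- by rewrite mulmx0; exact: in_span0.
- by rewrite mulmxDr -scalemxAr; exact: in_spanL.
by apply: P_span; exact: PM.
Qed.

Lemma in_span_adj A : in_span A -> in_span (adjmx A).
Proof.
move: A; apply: in_span_ind => [|a A A' hA hA'|U PUU].
- by rewrite -[0](scale0r 1%:M) adjmxZ rmorph0 scale0r; exact: in_span0.
- by rewrite adjmxD adjmxZ; exact: in_spanL.
exact/P_span/Padj.
Qed.

Lemma in_span_comm B : (forall U, P U -> B *m U = U *m B) ->
  forall A, in_span A -> B *m A = A *m B.
Proof.
move=> hB; apply: in_span_ind => [|a A A' hA hA'|U PUU]; last exact: hB.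
- by rewrite mulmx0 mul0mx.
- by rewrite mulmxDr mulmxDl -scalemxAr -scalemxAl hA hA'.
Qed.

Definition twirl_sum (T : 'M[C]_m) := \sum_k K k *m T *m adjmx (K k).

(** The matrix [a] expressing [L] in terms of [K] satisfies [a *m adjmx a = 1]; being square it also
    satisfies [adjmx a *m a = 1], which collapses the double sum to its diagonal. *)
Lemma twirl_sum_basis (L : 'I_v -> 'M[C]_m) T :
  (forall k, in_span (L k)) ->
  (forall k l, \tr (L k *m adjmx (L l)) = (k == l)%:R) ->
  \sum_k L k *m T *m adjmx (L k) = twirl_sum T.
Proof.
move=> LV L_ortho; pose a : 'M[C]_v := \matrix_(k, l) \tr (L k *m adjmx (K l)).
have LE k : L k = \sum_l a k l *: K l.
  by rewrite {1}(LV k); apply: eq_bigr => l _; rewrite mxE.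
have aV : a *m adjmx a = 1%:M.
  apply/matrixP => k l; rewrite !mxE -L_ortho LE.
  rewrite mulmx_suml mxtrace_sum; apply: eq_bigr => j _ /=.
  rewrite -scalemxAl mxtraceZ !mxE; congr (_ * _).
  by rewrite -tr_adjmx adjmxM adjmxK.
have Va := mulmx1C aV.
rewrite /twirl_sum.
transitivity (\sum_j \sum_l (adjmx a *m a) l j *: (K j *m T *m adjmx (K l))).
  under eq_bigr => k _.
    rewrite {1}LE LE adjmx_sum !mulmx_suml.
    under eq_bigr => j _.
      rewrite mulmx_sumr; under eq_bigr => l _ do
        rewrite adjmxZ -!scalemxAl -scalemxAr scalerA.
      over.
    over.
  rewrite exchange_big /=; apply: eq_bigr => j _.
  rewrite exchange_big /=; apply: eq_bigr => l _.
  rewrite -scaler_suml; congr (_ *: _); rewrite mxE.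
  by apply: eq_bigr => k _; rewrite !mxE mulrC.
rewrite Va; apply: eq_bigr => j _; rewrite (bigD1 j) //= big1 ?addr0.
  by rewrite mxE eqxx scale1r.
by move=> l lj; rewrite mxE (negPf lj) scale0r.
Qed.

Lemma unitary_adj_mul U : P U -> adjmx U *m U = 1%:M.
Proof. by move=> /PU /mulmx1C. Qed.

(** Left multiplication by a unitary [U] of [P] turns [K] into another orthonormal basis of the same
    span, so conjugation by [U] fixes the sum. *)
Lemma twirl_sum_comm T U : P U -> twirl_sum T *m U = U *m twirl_sum T.
Proof.
move=> PUU.
have h : U *m twirl_sum T *m adjmx U = twirl_sum T.
  rewrite -[RHS](@twirl_sum_basis (fun k => U *m K k)).
  - rewrite mulmx_sumr mulmx_suml; apply: eq_bigr => k _.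
    by rewrite adjmxM !mulmxA.
  - by move=> k; apply: in_spanM; [exact: P_span | exact: in_span_basis].
  - move=> k l; rewrite -K_ortho adjmxM mulmxA mxtrace_mulC !mulmxA.
    by rewrite unitary_adj_mul ?mul1mx.
by rewrite -{1}h -!mulmxA unitary_adj_mul ?mulmx1.
Qed.

(** The adjoints of the [K k] form another orthonormal basis, as the span is closed under
    adjoints. *)
Lemma twirl_sum_adj T : \sum_k adjmx (K k) *m T *m K k = twirl_sum T.
Proof.
rewrite -(@twirl_sum_basis (fun k => adjmx (K k))).
- by apply: eq_bigr => k _; rewrite adjmxK.
- by move=> k; apply: in_span_adj; exact: in_span_basis.
by move=> k l; rewrite adjmxK mxtrace_mulC K_ortho eq_sym.
Qed.

Let D := twirl_sum 1%:M.

Let DE : D = \sum_k K k *m adjmx (K k).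
Proof. by apply: eq_bigr => k _; rewrite mulmx1. Qed.

Let D_herm : adjmx D = D.
Proof.
by rewrite DE adjmx_sum; apply: eq_bigr => k _; rewrite adjmxM adjmxK.
Qed.

Let D_span : in_span D.
Proof.
rewrite DE; apply: in_span_sum => k; apply: in_spanM; first exact: in_span_basis.
by apply: in_span_adj; exact: in_span_basis.
Qed.

Let D_comm A : in_span A -> D *m A = A *m D.
Proof. by apply: in_span_comm => U; exact: twirl_sum_comm. Qed.

Let D_tr : \tr D = v%:R.
Proof.
rewrite DE mxtrace_sum /=; under eq_bigr => k _ do rewrite K_ortho eqxx.
by rewrite sumr_const card_ord.
Qed.

Let D_hsip n (A : 'M[C]_(n, m)) : hsip (A *m D) A = \sum_k hsip (A *m K k) (A *m K k).
Proof.
rewrite /hsip DE mulmx_sumr mulmx_suml mxtrace_sum Re_sum.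
by apply: eq_bigr => k _; rewrite adjmxM !mulmxA.
Qed.

Let D_unit : D \in unitmx.
Proof.
rewrite -row_free_unit; apply: inj_row_free => x xD0.
have := D_hsip x; rewrite xD0.
have -> : hsip 0 x = 0 by rewrite /hsip mul0mx mxtrace0.
(* A kernel vector of [D] is killed by every [K k], hence by the identity, which lies in their
   span. *)
move/esym/psumr_eq0P => h; rewrite -[x]mulmx1 (P_span P1) mulmx_sumr big1 // => k _.
by rewrite -scalemxAr (hsip_eq0 (h (fun k _ => hsip_ge0 _) k isT)) scaler0.
Qed.

Let functional_bound n q (y : 'M[C]_(n, m)) (W : 'M[C]_(m, q)) i0 i
    (f := fun A : 'M[C]_m => (y *m A *m W) i0 i) :
  complex.Re (f D * Num.conj (f D)) <=
  v%:R * \sum_k complex.Re (f (D *m K k) * Num.conj (f (K k))).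
Proof.
(* [H] represents [f] on the span; the bound is the Cauchy-Schwarz inequality for the
   form [(A, B) |-> tr (A D adjmx B)] at [adjmx H] and the identity. *)
pose H := \sum_k Num.conj (f (K k)) *: K k.
have fE A : in_span A -> f A = \tr (A *m adjmx H).
  move=> hA; rewrite {1}hA /f mulmx_sumr mulmx_suml summxE.
  rewrite /H adjmx_sum mulmx_sumr mxtrace_sum; apply: eq_bigr => k _ /=.
  by rewrite adjmxZ -!scalemxAr -scalemxAl mxE conjCK mxtraceZ mulrC.
have -> : \sum_k complex.Re (f (D *m K k) * Num.conj (f (K k))) =
    hsip (adjmx H *m D) (adjmx H).
  rewrite -Re_sum /hsip adjmxK [in RHS]/H mulmx_sumr mxtrace_sum.
  congr (complex.Re _); apply: eq_bigr => k _ /=.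
  rewrite fE; last by apply: in_spanM => //; exact: in_span_basis.
  by rewrite -scalemxAr mxtraceZ mulrC -[in RHS]mulmxA [in RHS]mxtrace_mulC.
rewrite fE //; set t := \tr _.
set Q := hsip _ _.
have [v0|v_gt0] := posnP v.
  have -> : t = 0.
    by rewrite /t DE big1 ?mul0mx ?mxtrace0 // => -[k kv] _; exfalso; rewrite v0 in kv.
  by rewrite mul0r v0 mul0r.
(* Here [t = f D]. Since [D] has trace [v], the expansion is [v^2 Q - 2 v N + v N] with [N] the
   squared modulus of [t]; dividing by [v] gives the bound. *)
have : 0 <= hsip ((v%:R%:C%C *: adjmx H - t *: 1%:M) *m D)
    (v%:R%:C%C *: adjmx H - t *: 1%:M).
  by rewrite D_hsip; apply: sumr_ge0 => k _; exact: hsip_ge0.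
have tHD : \tr (adjmx H *m D) = t by rewrite mxtrace_mulC.
rewrite mulmxBl -!scalemxAl mul1mx !(hsipDl, hsipDr, hsipNl, hsipNr, hsipZl, hsipZr).
rewrite -/Q; set N := complex.Re _.
have -> : hsip (adjmx H *m D) (t *: 1%:M) = N.
  by rewrite /hsip adjmxZ adjmx1 -scalemxAr mulmx1 mxtraceZ tHD mulrC.
have -> : hsip (t *: D) (adjmx H) = N.
  by rewrite hsipC /hsip adjmxZ D_herm -scalemxAr mxtraceZ tHD mulrC.
have -> : hsip (t *: D) (t *: 1%:M) = v%:R * N.
  rewrite /hsip adjmxZ adjmx1 -scalemxAl -!scalemxAr mulmx1 !mxtraceZ D_tr mulrA mulrC.
  by rewrite -Re_real_mul rmorph_nat.
have v0 : 0 < v%:R :> R by rewrite ltr0n.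
move=> h; rewrite -(ler_pM2l v0) -subr_ge0; move: h; congr (0 <= _); ring.
Qed.

Definition twirl (T : 'M[C]_m) := invmx D *m twirl_sum T.

Lemma twirl_comm T U : P U -> twirl T *m U = U *m twirl T.
Proof.
move=> PUU; rewrite /twirl -mulmxA twirl_sum_comm // !mulmxA; congr (_ *m _).
rewrite -{1}[U](mulmxK D_unit) -D_comm; last exact: P_span.
by rewrite -!mulmxA mulKmx.
Qed.

Let twirl_sum_D T : twirl_sum T *m D = D *m twirl_sum T.
Proof.
by apply: in_span_comm => // U; exact: twirl_sum_comm.
Qed.

Let twirlE T : twirl T = twirl_sum T *m invmx D.
Proof.
by rewrite /twirl -{1}[twirl_sum T](mulmxK D_unit) twirl_sum_D -mulmxA mulKmx.
Qed.

Lemma twirl_herm T : adjmx T = T -> adjmx (twirl T) = twirl T.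
Proof.
move=> Th; rewrite {1}twirlE /twirl adjmxM; congr (_ *m _).
  have h : adjmx (invmx D) *m D = 1%:M.
    by rewrite -{2}D_herm -adjmxM mulmxV // adjmx1.
  by rewrite -[RHS]mul1mx -h mulmxK.
rewrite /twirl_sum adjmx_sum; apply: eq_bigr => k _.
by rewrite !adjmxM adjmxK Th mulmxA.
Qed.

(** Both [rho] and the inverse of [D] commute with every [K k]. Cycling the trace therefore collects
    the sum of [adjmx (K k) *m K k], which is [D] by [twirl_sum_adj] and cancels its inverse. *)
Lemma twirl_tr rho T : (forall U, P U -> rho *m U = U *m rho) ->
  \tr (rho *m twirl T) = \tr (rho *m T).
Proof.
move=> rho_comm.
have rhoV A : in_span A -> rho *m A = A *m rho by apply: in_span_comm.
rewrite /twirl mulmxA; set N := invmx D.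
have NK k : N *m K k = K k *m N.
  rewrite -{1}[K k](mulmxK D_unit) -D_comm; last exact: in_span_basis.
  by rewrite -!mulmxA mulKmx.
rewrite /twirl_sum mulmx_sumr mxtrace_sum.
transitivity (\sum_k \tr (adjmx (K k) *m K k *m (rho *m N *m T))).
  apply: eq_bigr => k _; rewrite mulmxA mxtrace_mulC !mulmxA; congr (\tr (_ *m _)).
  rewrite -!mulmxA; congr (_ *m _).
  by rewrite NK [LHS]mulmxA (rhoV _ (in_span_basis k)) -mulmxA.
rewrite -mxtrace_sum -mulmx_suml.
have -> : \sum_k adjmx (K k) *m K k = D.
  by rewrite /D -twirl_sum_adj; apply: eq_bigr => k _; rewrite mulmx1.
by rewrite !mulmxA -rhoV // mulmxK.
Qed.

(** Factor [T = W *m adjmx W] and put [x = y D]. Both sides become sums over the columns of [W], and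
    [functional_bound] compares them column by column. *)
Lemma twirl_ge T (x : 'rV[C]_m) : psdmx T ->
  hsip (x *m T) x <= v%:R * hsip (x *m twirl T) x.
Proof.
move=> /psdmx_factor[Z ->]; set W := adjmx Z.
have ZE : Z = adjmx W by rewrite adjmxK.
rewrite -[x](mulmxKV D_unit); set y := x *m _.
have -> : hsip (y *m D *m (W *m Z)) (y *m D) = \sum_i
    complex.Re ((y *m D *m W) 0 i * Num.conj ((y *m D *m W) 0 i)).
  rewrite -Re_sum /hsip ZE !mulmxA -!mulmxA -adjmxM /mxtrace big_ord1 !mulmxA mxE.
  by congr (complex.Re _); apply: eq_bigr => i _; rewrite !mxE.
have -> : hsip (y *m D *m twirl (W *m Z)) (y *m D) = \sum_i \sum_k
    complex.Re ((y *m (D *m K k) *m W) 0 i * Num.conj ((y *m K k *m W) 0 i)).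
  rewrite exchange_big /= /twirl -mulmxA mulKVmx //.
  rewrite -[X in hsip _ (y *m X)]D_herm -hsip_adj -mulmxA twirl_sum_D /hsip.
  rewrite /twirl_sum !(mulmx_sumr, mulmx_suml) mxtrace_sum Re_sum.
  apply: eq_bigr => k _; rewrite -Re_sum; congr (complex.Re _).
  rewrite ZE (_ : _ *m adjmx y = y *m (D *m K k) *m W *m adjmx (y *m K k *m W)).
    by rewrite /mxtrace big_ord1 mxE; apply: eq_bigr => i _; rewrite !mxE.
  by rewrite !adjmxM !mulmxA.
by rewrite mulr_sumr ler_sum // => i _; exact: functional_bound.
Qed.

(** For [v > 0] positivity follows from [twirl_ge]; for [v = 0] the identity is an empty sum, so
    every vector is zero. *)
Lemma twirl_psd T : psdmx T -> psdmx (twirl T).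
Proof.
move=> T_psd; apply/psdmxP; split; first by rewrite twirl_herm //; case: T_psd.
move=> x; have [v0|v_gt0] := posnP v; last first.
  rewrite -(pmulr_rge0 _ (_ : 0 < v%:R :> R)) ?ltr0n //.
  exact: le_trans (psdmx_hsip_ge0 x T_psd) (twirl_ge x T_psd).
have x0 : x = 0.
  rewrite -[x]mulmx1 (P_span P1) big1 ?mulmx0 // => -[k kv] _.
  by exfalso; rewrite v0 in kv.
by rewrite x0 mul0mx hsip_ge0.
Qed.

End Twirl.

(** * Orthonormal bases of spans of arbitrary sets of matrices *)

Section SpanBasis.
Variable R : realType.
Local Notation C := R[i].

(** A family of maximal rank with rows in [Q] is chosen; appending a further row from [Q] cannot
    raise the rank, so that row already lies in the row space. *)
Lemma ex_spanning_rows N (Q : 'rV[C]_N -> Prop) : exists (r : nat) (A : 'M[C]_(r, N)),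
  (forall i, Q (row i A)) /\ forall x, Q x -> (x <= A)%MS.
Proof.
pose rk k := `[< exists (r : nat) (A : 'M[C]_(r, N)),
  (forall i, Q (row i A)) /\ \rank A = k >].
have rk0 : exists k, rk k.
  exists 0%N; apply/asboolP; exists 0%N, 0; split; last exact: mxrank0.
  by case.
have rk_le k : rk k -> (k <= N)%N.
  by move=> /asboolP[r [A [_ <-]]]; exact: rank_leq_col.
case: (ex_maxnP rk0 rk_le) => k /asboolP[r [A [QA rA]]] maxk.
exists r, A; split=> // x Qx.
have rx : rk (\rank (col_mx A x)).
  apply/asboolP; exists (r + 1)%N, (col_mx A x); split=> // i.
  case: (splitP i) => j ij.
    have -> : i = lshift 1 j by exact: val_inj.
    by rewrite rowKu.
  have -> : i = rshift r j by exact: val_inj.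
  by rewrite rowKd ord1; have -> : row 0 x = x by apply/rowP => l; rewrite mxE.
have := maxk _ rx; rewrite -rA => h.
have sA : (A <= col_mx A x)%MS by rewrite -addsmxE addsmxSl.
have := mxrank_leqif_sup sA => -[_]; rewrite eqn_leq mxrankS //= h => /esym.
by apply: submx_trans; rewrite -addsmxE addsmxSr.
Qed.

Lemma mxtrace_mxvec m (A B : 'M[C]_m) :
  \tr (A *m adjmx B) = (mxvec A *m adjmx (mxvec B)) 0 0.
Proof.
rewrite mxE /mxtrace; under eq_bigr do rewrite mxE.
rewrite pair_bigA /= (reindex _ (curry_mxvec_bij m m)) /=.
by apply: eq_bigr => -[i j] _ /=; rewrite !mxE !mxvecE.
Qed.

(** Gram-Schmidt is applied to a row basis of vectorised members of [P]. The rows of [A] provide the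
    [X j], and their inclusion in [W] bounds the dimension by [k]. *)
Lemma ex_orthonormal_basis m (P : 'M[C]_m -> Prop) k (W : 'M[C]_(k, m * m)) :
  (forall U, P U -> (mxvec U <= W)%MS) ->
  exists v r (K : 'I_v -> 'M[C]_m) (X : 'I_r -> 'M[C]_m) (Y : 'M[C]_(v, r)),
  [/\ (v <= k)%N, forall j, P (X j), forall k, K k = \sum_j Y k j *: X j,
     forall k l, \tr (K k *m adjmx (K l)) = (k == l)%:R &
     forall U, P U -> U = \sum_k \tr (U *m adjmx (K k)) *: K k].
Proof.
move=> PW; have [r [A [QA spA]]] := ex_spanning_rows (fun x => P (vec_mx x)).
have free_base : row_free (row_base A) by exact: row_base_free.
pose B := schmidt (row_base A).
have BU : B \is unitarymx by apply: schmidt_unitarymx; exact: rank_leq_col.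
have BE : (B :=: A)%MS := eqmx_trans (eqmx_schmidt_free free_base) (eq_row_base A).
have /submxP[Y YE] : (B <= A)%MS by rewrite BE.
have BV : B *m adjmx B = 1%:M by rewrite -(unitarymxP BU) /adjmx map_trmx.
exists (\rank A), r, (fun k => vec_mx (row k B)), (fun j => vec_mx (row j A)), Y.
split=> //.
- apply: leq_trans (rank_leq_row W); apply: mxrankS; apply/row_subP => i.
  by rewrite -[row i A]vec_mxK; exact: PW.
- move=> i; rewrite YE row_mul mulmx_sum_row linear_sum /=.
  by apply: eq_bigr => j _; rewrite linearZ /= !mxE.
- move=> i j; rewrite mxtrace_mxvec !vec_mxK.
  have -> : (i == j)%:R = (1%:M : 'M[C]__) i j by rewrite mxE.
  by rewrite -BV !mxE; apply: eq_bigr => l _; rewrite !mxE.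
move=> U PU.
have /submxP[a aE] : (mxvec U <= B)%MS by rewrite BE; apply: spA; rewrite mxvecK.
rewrite -{1}[U]mxvecK aE mulmx_sum_row linear_sum /=.
apply: eq_bigr => j _; rewrite linearZ /=; congr (_ *: _).
rewrite mxtrace_mxvec vec_mxK aE.
have -> : a 0 j = (a *m B *m adjmx B) 0 j by rewrite -mulmxA BV mulmx1.
by rewrite !mxE; apply: eq_bigr => l _; rewrite !mxE.
Qed.

End SpanBasis.

(** * Tensor powers and the dimension of their span *)

Section TensorPowers.
Variable R : realType.
Local Notation C := R[i].

Lemma tensmx11 m n : (1%:M : 'M[C]_m) *t (1%:M : 'M[C]_n) = 1%:M.
Proof.
apply/matrixP => i j.
case: (mxtens_indexP i) => i0 i1; case: (mxtens_indexP j) => j0 j1.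
rewrite tensmxE !mxE -natrM mulnb (can_eq (@mxtens_indexK _ _)).
by rewrite xpair_eqE.
Qed.

Lemma mxtrace_tens m n (A : 'M[C]_m) (B : 'M[C]_n) : \tr (A *t B) = \tr A * \tr B.
Proof. by rewrite /mxtrace mulr_sum; apply: eq_bigr => i _; rewrite mxE. Qed.

Lemma ntensmxM d n (A B : 'M[C]_d) : (A *m B) ^t n = A ^t n *m B ^t n.
Proof.
case: n => [|n]; first by rewrite !ntensmx0 mulmx1.
by elim: n => [|n IHn]; rewrite ?ntensmx1 // !ntensmxSS IHn tensmx_mul.
Qed.

Lemma adjmx_ntens d n (A : 'M[C]_d) : adjmx (A ^t n) = adjmx A ^t n.
Proof.
case: n => [|n]; first by rewrite !ntensmx0 adjmx1.
elim: n => [|n IHn]; rewrite ?ntensmx1 // !ntensmxSS -IHn /adjmx.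
by rewrite map_mxT trmx_tens.
Qed.

Lemma ntensmx1n d n : (1%:M : 'M[C]_d) ^t n = 1%:M.
Proof.
case: n => [|n] //.
by elim: n => [|n IHn]; rewrite ?ntensmx1 // !ntensmxSS IHn tensmx11.
Qed.

Lemma mxtrace_ntens d n (A : 'M[C]_d) : \tr (A ^t n) = \tr A ^+ n.
Proof.
case: n => [|n]; first by rewrite ntensmx0 mxtrace1.
by elim: n => [|n IHn]; rewrite ?ntensmx1 // ntensmxSS mxtrace_tens IHn -exprS.
Qed.

Lemma psdmx_ntens d n (A : 'M[C]_d) : psdmx A -> psdmx (A ^t n).
Proof.
by move=> /psdmx_factor[Y ->]; rewrite ntensmxM -adjmx_ntens; exact: psdmx_gram.
Qed.

(** Terms are grouped along the fibres of [h], that is, by the monomial that multiplies them. *)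
Let collect (I J : finType) (V : lmodType C) (h : J -> I) (c : I -> C) (F : J -> V) :
  \sum_j c (h j) *: F j = \sum_i c i *: \sum_(j | h j == i) F j.
Proof.
rewrite (partition_big h predT) //=; apply: eq_bigr => i _.
by rewrite scaler_sumr; apply: eq_bigr => j /eqP ->.
Qed.

(* The entries of [A ^t n.+1] are monomials of degree [n.+1] in the entries of
   [A], so the tensor powers of all [A] lie in a space of dimension polynomial in
   [n]. *)
Lemma ntensmx_monomials d n :
  exists E : {ffun 'I_d * 'I_d -> 'I_n.+2} -> 'M[C]_(d ^ n.+1), forall A : 'M[C]_d,
    A ^t n.+1 = \sum_(t : {ffun 'I_d * 'I_d -> 'I_n.+2}) (\prod_p A p.1 p.2 ^+ t p) *: E t.
Proof.
elim: n => [|n [E IHn]].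
  pose h (p : 'I_d * 'I_d) : {ffun 'I_d * 'I_d -> 'I_2} := [ffun q => inord (p == q)].
  exists (fun t => \sum_(p | h p == t) delta_mx p.1 p.2) => A.
  rewrite ntensmx1 -(@collect _ _ _ h
    (fun t : {ffun 'I_d * 'I_d -> 'I_2} => \prod_p A p.1 p.2 ^+ t p)).
  rewrite {1}[A]matrix_sum_delta pair_bigA /=; apply: eq_bigr => p _; congr (_ *: _).
  rewrite (bigD1 p) //= ffunE eqxx inordK // expr1 big1 ?mulr1 // => q qp.
  by rewrite ffunE eq_sym (negPf qp) inordK.
pose I1 := ('I_d * 'I_d)%type; pose I2 := {ffun I1 -> 'I_n.+2}.
(* One more factor raises the exponent of the entry [j.1] by one; the new exponent stays below
   [n.+3], so [inord] does not truncate. *)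
pose h (j : I1 * I2) : {ffun I1 -> 'I_n.+3} := [ffun q => inord (j.2 q + (j.1 == q))].
exists (fun t => \sum_(j | h j == t) delta_mx j.1.1 j.1.2 *t E j.2) => A.
rewrite -(@collect _ _ _ h (fun t : {ffun I1 -> 'I_n.+3} => \prod_p A p.1 p.2 ^+ t p)
  (fun j => delta_mx j.1.1 j.1.2 *t E j.2)).
rewrite ntensmxSS IHn {1}[A]matrix_sum_delta pair_bigA /=.
transitivity (\sum_(p : I1) \sum_(t : I2)
  (A p.1 p.2 * \prod_q A q.1 q.2 ^+ t q) *: (delta_mx p.1 p.2 *t E t)).
  apply/matrixP => i j.
  case: (mxtens_indexP i) => i0 i1; case: (mxtens_indexP j) => j0 j1.
  rewrite tensmxE !summxE mulr_suml; apply: eq_bigr => p _.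
  rewrite summxE mulr_sumr; apply: eq_bigr => t _.
  by rewrite [in RHS]mxE tensmxE [in LHS]mxE [X in _ * X]mxE; ring.
rewrite pair_bigA /=; apply: eq_bigr => -[p t] _ /=; congr (_ *: _).
rewrite [in RHS](bigD1 p) //= [in LHS](bigD1 p) //= mulrA.
have tlt q : (t q + (p == q) < n.+3)%N.
  by have := ltn_ord (t q); case: (p == q) => /=; lia.
congr (_ * _); first by rewrite ffunE inordK // eqxx addn1 exprS.
by apply: eq_bigr => q qp; rewrite ffunE inordK // eq_sym (negPf qp) addn0.
Qed.

(** The dimension bound counts all exponent vectors: [d * d] entries, each with an exponent from [0]
    to [n.+1]. *)
Lemma ntensmx_span d n : exists W : 'M[C]_(n.+2 ^ (d * d), d ^ n.+1 * d ^ n.+1),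
  forall A : 'M[C]_d, (mxvec (A ^t n.+1) <= W)%MS.
Proof.
have [E EP] := ntensmx_monomials d n.
pose I := {ffun 'I_d * 'I_d -> 'I_n.+2}.
have cI : #|{: I}| = (n.+2 ^ (d * d))%N by rewrite card_ffun card_prod !card_ord.
rewrite -cI; exists (\matrix_i mxvec (E (enum_val i))) => A.
rewrite EP linear_sum; apply: summx_sub => t _; rewrite linearZ scalemx_sub //.
apply: submx_trans (row_sub (enum_rank t) _).
by rewrite rowK enum_rankK.
Qed.

End TensorPowers.

(** * From an arbitrary test to an invariant one *)

Section InvariantTests.
Variable R : realType.
Local Notation C := R[i].

Lemma psdmx_le_tr n (rho A B : 'M[C]_n) : psdmx rho -> psdmx (B - A) ->
  complex.Re (\tr (rho *m A)) <= complex.Re (\tr (rho *m B)).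
Proof.
move=> rho_psd /(psdmx_tr_ge0 rho_psd).
by rewrite mulmxDr mulmxN mxtraceD raddfD /= raddfN raddfN subr_ge0.
Qed.

(** The first error is controlled by [resolvent_test_compl_le] and [\tr r0 = 1]. The second is
    controlled by [resolvent_test_le], after which the invariance of [r1] replaces the twirl of [T]
    by [T] itself. *)
Lemma invariant_test m (P : 'M[C]_m -> Prop) k (W : 'M[C]_(k, m * m))
    (r0 r1 T : 'M[C]_m) (lam : R) :
  P 1%:M -> (forall U V, P U -> P V -> P (U *m V)) ->
  (forall U, P U -> P (adjmx U)) -> (forall U, P U -> U *m adjmx U = 1%:M) ->
  (forall U, P U -> (mxvec U <= W)%MS) -> (0 < k)%N ->
  psdmx r0 -> \tr r0 = 1 -> psdmx r1 -> (forall U, P U -> r1 *m U = U *m r1) ->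
  psdmx T -> psdmx (1%:M - T) -> 0 < lam ->
  exists T' : 'M[C]_m,
    [/\ forall U, P U -> T' *m U = U *m T', psdmx T', psdmx (1%:M - T'),
      complex.Re (\tr (r0 *m (1%:M - T'))) <=
        complex.Re (\tr (r0 *m (1%:M - T))) + k%:R * lam &
      complex.Re (\tr (r1 *m T')) <= lam^-1 * complex.Re (\tr (r1 *m T))].
Proof.
move=> P1 PM Padj PU PW k_gt0 r0_psd r0_tr r1_psd r1_comm T_psd T_le1 lam_gt0.
have [v [r [K [X [Y [vk PX KE K_ortho P_span]]]]]] := ex_orthonormal_basis PW.
pose S := twirl K T.
have S_psd : psdmx S by apply: (twirl_psd P1 PM Padj PU PX KE K_ortho P_span T_psd).
have T_leS (x : 'rV[C]_m) : hsip (x *m T) x <= k%:R * hsip (x *m S) x.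
  apply: le_trans (twirl_ge P1 PM Padj PU PX KE K_ortho P_span x T_psd) _.
  by rewrite ler_wpM2r ?ler_nat // psdmx_hsip_ge0.
have k0 : 0 < k%:R :> R by rewrite ltr0n.
exists (resolvent_test S lam); split.
- move=> U PUU; apply: (resolvent_test_comm S_psd lam_gt0).
  exact: (twirl_comm P1 PM PU PX KE K_ortho P_span).
- exact: resolvent_test_psd.
- exact: resolvent_test_compl_psd.
- have := psdmx_le_tr r0_psd (resolvent_test_compl_le S_psd T_psd T_le1 k0 lam_gt0 T_leS).
  set c := (_ * lam)%:C%C; rewrite (mulmxDr _ (1%:M - T) (c *: 1%:M)) mxtraceD.
  by rewrite -scalemxAr mulmx1 mxtraceZ r0_tr mulr1; case: (\tr (_ *m (1%:M - T))).
have := psdmx_le_tr r1_psd (resolvent_test_le S_psd lam_gt0).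
rewrite -scalemxAr mxtraceZ Re_real_mul.
by rewrite (twirl_tr P1 PM Padj PU PX KE K_ortho P_span T r1_comm).
Qed.

Lemma perr_split d n (r0 r1 : 'M[C]_d) (T : 'M[C]_(d ^ n)) :
  perr r0 r1 T = complex.Re (\tr (r0 ^t n *m (1%:M - T))) + complex.Re (\tr (r1 ^t n *m T)).
Proof. by rewrite /perr raddfD. Qed.

(** * Comparison of the two minimal error probabilities *)

Section MinimalErrors.
Variables (d : nat) (r0 r1 : 'M[C]_d).
Hypotheses (r0_dens : density r0) (r1_dens : density r1).

Lemma perr_terms_ge0 n (T : 'M[C]_(d ^ n)) : psdmx T -> psdmx (1%:M - T) ->
  0 <= complex.Re (\tr (r0 ^t n *m (1%:M - T))) /\ 0 <= complex.Re (\tr (r1 ^t n *m T)).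
Proof.
case: r0_dens r1_dens => r0_psd _ [r1_psd _] T_psd T_le1.
by split; apply: psdmx_tr_ge0 => //; exact: psdmx_ntens.
Qed.

Lemma perr_ge0 n (T : 'M[C]_(d ^ n)) : psdmx T -> psdmx (1%:M - T) -> 0 <= perr r0 r1 T.
Proof. by move=> T0 T1; have [a b] := perr_terms_ge0 T0 T1; rewrite perr_split addr_ge0. Qed.

(** The null test is invariant and has error one: it shows that the sets under [inf] are nonempty
    and bounds the minimal error by one. *)
Lemma perr0 n : perr r0 r1 (0 : 'M[C]_(d ^ n)) = 1.
Proof.
case: r0_dens => _ tr0.
by rewrite /perr subr0 mulmx1 mulmx0 mxtrace0 addr0 mxtrace_ntens tr0 expr1n.
Qed.

Let null_test n : psdmx (0 : 'M[C]_(d ^ n)) /\ psdmx (1%:M - 0 : 'M[C]_(d ^ n)).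
Proof. by rewrite subr0; split; [exact: psdmx0 | exact: psdmx1]. Qed.

Lemma Pmin_full_ge0 n : 0 <= Pmin_full r0 r1 n.
Proof.
apply: lb_le_inf.
  by exists (perr r0 r1 (0 : 'M[C]_(d ^ n))), 0 => //; exact: null_test.
by move=> _ [T [T0 T1] <-]; exact: perr_ge0.
Qed.

Lemma Pmin_full_le1 n : Pmin_full r0 r1 n <= 1.
Proof.
apply: ge_inf; last by exists 0; [exact: null_test | exact: perr0].
by exists 0 => _ [T [T0 T1] <-]; exact: perr_ge0.
Qed.

Variables (G : Type) (u : G -> 'M[C]_d).

Lemma Pmin_full_le_inv n : Pmin_full r0 r1 n <= Pmin_inv u r0 r1 n.
Proof.
apply: lb_le_inf.
  exists (perr r0 r1 (0 : 'M[C]_(d ^ n))), 0 => //.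
  by have [T0 T1] := null_test n; split=> // g; rewrite mulmx0 mul0mx.
move=> _ [T [_ T0 T1] <-]; apply: ge_inf; last by exists T.
by exists 0 => _ [T' [T'0 T'1] <-]; exact: perr_ge0.
Qed.

Hypotheses (u1 : exists g, u g = 1%:M)
  (uM : forall g h, exists gh, u gh = u g *m u h)
  (uadj : forall g, exists h, u h = adjmx (u g))
  (uU : forall g, u g *m adjmx (u g) = 1%:M)
  (r1_inv : forall g, r1 *m u g = u g *m r1).

(** The strict inequality yields a test of error below [x ^+ 2] without requiring the infimum to be
    attained. With [lam = x] its first error grows by at most [x] times the dimension bound, and its
    second becomes at most [x ^+ 2 / x]. *)
Lemma Pmin_inv_le_test n (x : R) : 0 < x -> Pmin_full r0 r1 n.+1 < x ^+ 2 ->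
  Pmin_inv u r0 r1 n.+1 <= x ^+ 2 + ((n.+2 ^ (d * d))%:R + 1) * x.
Proof.
move=> x_gt0 /inf_lt[].
  by exists (perr r0 r1 (0 : 'M[C]_(d ^ n.+1))), 0 => //; exact: null_test.
move=> _ [T [T0 T1] <-] Tx; have [W WP] := ntensmx_span R d n.
case: r0_dens r1_dens => r0_psd r0_tr [r1_psd _].
have [] := @invariant_test _ (fun U => exists g, U = u g ^t n.+1) _ W
  (r0 ^t n.+1) (r1 ^t n.+1) T x => //.
- by case: u1 => g ug; exists g; rewrite ug ntensmx1n.
- move=> _ _ [g ->] [h ->]; have [gh ugh] := uM g h.
  by exists gh; rewrite ugh ntensmxM.
- by move=> _ [g ->]; have [h uh] := uadj g; exists h; rewrite uh adjmx_ntens.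
- by move=> _ [g ->]; rewrite adjmx_ntens -ntensmxM uU ntensmx1n.
- by move=> _ [g ->]; exact: WP.
- by rewrite expn_gt0.
- exact: psdmx_ntens.
- by rewrite mxtrace_ntens r0_tr expr1n.
- exact: psdmx_ntens.
- by move=> _ [g ->]; rewrite -!ntensmxM r1_inv.
move=> T' [T'comm T'0 T'1 e0 e1].
have := perr_terms_ge0 T0 T1; rewrite perr_split in Tx.
move: e0 e1 Tx; set k := _%:R; set a := complex.Re _; set b := complex.Re _.
set a' := complex.Re _; set b' := complex.Re _ => e0 e1 Tx [a'0 b'0].
apply: (@le_trans _ _ (perr r0 r1 T')).
  apply: ge_inf; first by exists 0 => _ [T'' [_ T''0 T''1] <-]; exact: perr_ge0.
  by exists T' => //; split=> // g; apply: T'comm; exists g.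
have : x^-1 * b' <= x.
  by rewrite mulrC ler_pdivrMr // -expr2; lra.
rewrite perr_split -/a -/b; lra.
Qed.

Lemma Pmin_inv_le n :
  Pmin_inv u r0 r1 n.+1 <= ((n.+2 ^ (d * d))%:R + 2) * Num.sqrt (Pmin_full r0 r1 n.+1).
Proof.
set k := _%:R; set p := Pmin_full _ _ _; set s := Num.sqrt p.
have p0 : 0 <= p := Pmin_full_ge0 n.+1.
have s0 : 0 <= s := sqrtr_ge0 p.
have s1 : s <= 1 by rewrite -sqrtr1 ler_wsqrtr // Pmin_full_le1.
have sE : s ^+ 2 = p by rewrite sqr_sqrtr.
have k0 : 0 <= k by rewrite ler0n.
(* As [s <= 1], the term [s ^+ 2] is at most [s], which accounts for the constant [2] in the
   bound. *)
apply: (@le_trans _ _ (s ^+ 2 + (k + 1) * s)); last by nra.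
apply/ler_addgt0Pr => e e_gt0.
(* The previous lemma is used at [s + t], slightly above the square root. For [t <= 1] the excess
   [2 s t + t^2 + (k + 1) t] is at most [t * M]. *)
pose M := 2 * s + k + 2; have M_gt0 : 0 < M by rewrite /M; lra.
pose t := Num.min 1 (e / M).
have t_gt0 : 0 < t by rewrite lt_min ltr01 divr_gt0.
have t1 : t <= 1 by rewrite ge_min lexx.
have tM : t * M <= e by rewrite -ler_pdivlMr // ge_min lexx orbT.
have := @Pmin_inv_le_test n (s + t); rewrite -/k -/p.
move=> /(_ (ltr_wpDl s0 t_gt0)) h.
apply: le_trans (h _) _; first by rewrite -sE; nra.
by rewrite /M in tM; nra.
Qed.

End MinimalErrors.
End InvariantTests.

(** * Exponential rates in the extended reals *)

Section Rates.
Variable R : realType.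
Local Open Scope classical_set_scope.

(** The comparison starts at index one, matching the bound on [Pmin_inv]; the tail suprema are
    compared from there on. *)
Lemma le_limn_esup_cvg (a b : (\bar R)^nat) (l : \bar R) :
  (forall n, a n.+1 <= b n.+1)%E -> b @ \oo --> l -> (limn_esup a <= l)%E.
Proof.
move=> ab bl; rewrite limn_esup_lim -(cvg_lim _ (cvg_esups bl)) //.
apply: lee_lim; [exact: is_cvg_esups | exact: is_cvg_esups|].
exists 1%N => // -[//|n] _; apply: ge_ereal_sup => _ [[//|k] /= nk <-].
by apply: le_trans (ab k) _; apply: ereal_sup_ubound; exists k.+1.
Qed.

Lemma le_limn_einf_cvg (a b : (\bar R)^nat) (l : \bar R) :
  (forall n, a n <= b n)%E -> a @ \oo --> l -> (l <= limn_einf b)%E.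
Proof.
move=> ab al; rewrite /limn_einf leeNr; apply: (@le_limn_esup_cvg _ (fun n => - a n)%E).
  by move=> n; rewrite leeN2.
exact: cvgeN.
Qed.

Lemma le_elog (x y : R) : x <= y -> (elog x <= elog y)%E.
Proof.
rewrite /elog => xy; case: ltP => [x0|_]; last by rewrite leNye.
by rewrite (lt_le_trans x0 xy) lee_fin ler_ln ?posrE // (lt_le_trans x0 xy).
Qed.

Lemma le_rate (P Q : nat -> R) n : P n <= Q n -> (rate P n <= rate Q n)%E.
Proof. by move=> PQ; rewrite /rate lee_wpmul2l ?lee_fin ?invr_ge0 // le_elog. Qed.

Lemma rate_mul_sqrt (c : R) (P : nat -> R) n : (0 < n)%N -> 0 < c -> 0 <= P n ->
  (((n%:R)^-1)%:E * elog (c * Num.sqrt (P n)) =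
   (ln c / n%:R)%:E + (2%:R^-1)%:E * rate P n)%E.
Proof.
(* If [P n = 0], both sides are [-oo]. *)
move=> n0 c0; rewrite /rate le_eqVlt => /predU1P[<-|p0].
  rewrite sqrtr0 mulr0 /elog ltxx gt0_muleNy ?lte_fin ?invr_gt0 ?ltr0n //.
  by rewrite gt0_muleNy ?lte_fin ?invr_gt0 // addeNy.
rewrite /elog p0 mulr_gt0 ?sqrtr_gt0 //.
rewrite lnM ?posrE ?sqrtr_gt0 //.
have -> : ln (P n) = 2 * ln (Num.sqrt (P n)).
  by rewrite -{1}(sqr_sqrtr (ltW p0)) lnXn ?sqrtr_gt0 // mulr_natl.
set i := n%:R^-1; set L := ln (Num.sqrt _).
by rewrite -!EFinM -EFinD; congr (_%:E); field.
Qed.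

Lemma ln_poly_div_cvg0 D :
  (fun n : nat => ln ((n.+1 ^ D)%:R + 2 : R) / n%:R) @ \oo --> (0 : R).
Proof.
rewrite -cvg_shiftS /=.
(* With [x = n + 2] and [y = n + 1], the majorant combines [ln (x ^+ D + 2) <= (D + 2) ln x],
   [ln x <= 2 sqrt x] and [sqrt x / y <= 2 sqrt (1 / y)]; the two factors [2] give the [4]. *)
have h0 : (fun n => 4 * (D + 2)%:R * Num.sqrt (n.+1%:R^-1 : R)) @ \oo --> (0 : R).
  have -> : 0 = 4 * (D + 2)%:R * Num.sqrt 0 :> R by rewrite sqrtr0 mulr0.
  apply: cvgMr.
  apply: continuous_cvg; [exact: sqrt_continuous | exact: cvg_harmonic].
apply: squeeze_cvgr (cvg_cst 0) h0.
apply: nearW => n; rewrite /=.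
have x2 : 2 <= n.+2%:R :> R by rewrite ler_nat.
rewrite natrX; move: x2; have -> : n.+2%:R = n.+1%:R + 1 :> R by rewrite -natr1.
have y1 : 1 <= n.+1%:R :> R by rewrite ler1n.
set y := n.+1%:R in y1 *; set x := y + 1 => x2.
have y0 : 0 < y by lra.
have xD1 : 1 <= x ^+ D by rewrite exprn_ege1 //; lra.
have xx : 0 < x by lra.
apply/andP; split; first by rewrite divr_ge0 ?ln_ge0 //; lra.
have h1 : ln (x ^+ D + 2) <= (D + 2)%:R * ln x.
  rewrite mulr_natl -lnXn // ler_ln ?posrE ?exprn_gt0 //; last by lra.
  have x4 : 4 <= x ^+ 2 by nra.
  by rewrite exprD; have := ler_wpM2l (le_trans ler01 xD1) x4; lra.
have h2 : ln x <= 2 * Num.sqrt x.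
  rewrite -{1}(sqr_sqrtr (ltW xx)) lnXn ?sqrtr_gt0 // -[ln _ *+ _]mulr_natl ler_pM2l //.
  by apply/ltW/ln_sublinear; rewrite sqrtr_gt0.
have h3 : Num.sqrt x / y <= 2 * Num.sqrt y^-1.
  rewrite -[X in _ / X](sqr_sqrtr (ltW y0)) expr2 invfM mulrA sqrtrV ?(ltW y0) //.
  rewrite ler_wpM2r ?invr_ge0 ?sqrtr_ge0 // ler_pdivrMr ?sqrtr_gt0 //.
  (* The claim reduces to [y + 1 <= 4 y], true since [y >= 1]. *)
  have -> : 2 = Num.sqrt (2 ^+ 2) :> R by rewrite sqrtr_sqr ger0_norm.
  by rewrite -sqrtrM // ler_wsqrtr // /x; lra.
apply: le_trans (ler_wpM2r _ h1) _; first by rewrite invr_ge0 ltW.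
apply: (@le_trans _ _ ((D + 2)%:R * (2 * (Num.sqrt x / y)))).
  by rewrite -mulrA ler_wpM2l // mulrA ler_wpM2r // invr_ge0 ltW.
rewrite [4 * _]mulrC -mulrA ler_wpM2l //.
by move: h3; move: (Num.sqrt x / y) (Num.sqrt y^-1) => p q h3; lra.
Qed.

End Rates.

Theorem theorem5p5 (R : realType) (d : nat) (G : topologicalType)
  (mul : G -> G -> G) (inv : G -> G) (e : G) (u : G -> 'M[R[i]]_d)
  (rho0 rho1 : 'M[R[i]]_d) :
  compact_unitary_rep mul inv e u ->
  density rho0 -> density rho1 ->
  (forall g, rho1 *m u g = u g *m rho1) ->
  cvgn (rate (Pmin_full rho0 rho1)) ->
  [/\ (limn (rate (Pmin_full rho0 rho1)) <= limn_einf (rate (Pmin_inv u rho0 rho1)))%E,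
      (limn_einf (rate (Pmin_inv u rho0 rho1)) <= limn_esup (rate (Pmin_inv u rho0 rho1)))%E &
      (limn_esup (rate (Pmin_inv u rho0 rho1))
         <= (2%:R^-1)%:E * limn (rate (Pmin_full rho0 rho1)))%E].
Proof.
move=> [[_ [_ mulV]] [_ [_ [[uM u1] [uU _]]]]] dens0 dens1 rho1_inv cvg_full.
split; [| exact: limn_einf_sup |].
  apply: le_limn_einf_cvg cvg_full => n; apply: le_rate.
  exact: Pmin_full_le_inv.
have uadj g : exists h, u h = adjmx (u g).
  (* Unitarity makes the adjoint of [u g] its inverse, which is the image of [inv g]. *)
  exists (inv g); have /mulmx1C gU := uU g.
  by rewrite -[LHS]mul1mx -gU -mulmxA -uM (mulV g).2 u1 mulmx1.
pose c n : R := (n.+1 ^ (d * d))%:R + 2.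
(* At index [n.+1] this is the rate of the bound in [Pmin_inv_le]: the square root gives the factor
   one half, the polynomial factor the first term. *)
pose b n : \bar R := ((ln (c n) / n%:R)%:E + (2%:R^-1)%:E * rate (Pmin_full rho0 rho1) n)%E.
apply: (@le_limn_esup_cvg _ _ b) => [n|].
  rewrite /b -rate_mul_sqrt //; last 2 first.
  - by rewrite /c ltr_wpDl // ler0n.
  - exact: Pmin_full_ge0.
  rewrite /rate lee_wpmul2l ?lee_fin ?invr_ge0 // le_elog //.
  apply: Pmin_inv_le => //.
  - by exists e.
  - by move=> g h; exists (mul g h).
(* The first term is finite and tends to zero, so the limit of the sum is well defined even when the
   rate tends to [-oo]. *)
rewrite -[(_ * limn _)%E]add0e; apply: cvgeD.
- by rewrite fin_num_adde_defr.
- by apply/fine_cvgP; split; [exact: nearW | exact: ln_poly_div_cvg0].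
- exact: cvgeZl.
Qed.
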